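(* There exists a universal constant $C>0$ such that the following holds. Let $n\ge 1$, let $K>0$, and let $X$ be a mean zero random vector in $\mathbb{R}^n$ which has the convex concentration property with constant $K$. Then for any real $n\times n$ matrix $A=[a_{ij}]_{i,j=1}^n$ and every $t>0$, $$\mathbb{P}\big(|X^TAX-\mathbb{E}(X^TAX)|\ge t\big)\le 2\exp\Big(-\frac1C\min\Big(\frac{t^2}{K^2\|A\|_{HS}^2\|\mathrm{Cov}(X)\|},\frac{t}{K^2\|A\|}\Big)\Big)\le 2\exp\Big(-\frac1C\min\Big(\frac{t^2}{2K^4\|A\|_{HS}^2},\frac{t}{K^2\|A\|}\Big)\Big).$$
   Context: $|\cdot|$ is the standard Euclidean norm on $\mathbb{R}^n$; $\|A\|_{HS}=(\sum_{i,j\le n}a_{ij}^2)^{1/2}$ is the Hilbert-Schmidt norm; $\|A\|=\sup_{|x|\le1}|Ax|$ is the operator norm; $\mathrm{Cov}(X)$ is the covariance matrix of $X$, and $\|\mathrm{Cov}(X)\|$ is its operator norm. A fraction with positive numerator and zero denominator is read as $+\infty$, and $\exp(-\infty)=0$. Convex concentration property: a random vector $X$ in $\mathbb{R}^n$ has the convex concentration property with constant $K$ if for every convex function $\varphi:\mathbb{R}^n\to\mathbb{R}$ that is 1-Lipschitz (with respect to $|\cdot|$), we have $\mathbb{E}|\varphi(X)|<\infty$ and for every $t>0$, $$\mathbb{P}(|\varphi(X)-\mathbb{E}\varphi(X)|\ge t)\le 2\exp(-t^2/K^2).$$ *)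

(* Defs.v *)
From HB Require Import structures.
From mathcomp Require Import all_boot all_order all_algebra.
From mathcomp Require Import all_classical all_reals all_analysis.

Set Implicit Arguments.
Unset Strict Implicit.
Unset Printing Implicit Defensive.

Import Order.TTheory GRing.Theory Num.Theory.
Import numFieldNormedType.Exports.

Local Open Scope classical_set_scope.
Local Open Scope ring_scope.

Section norms.
Context {R : realType}.

(* The library norm `|x| on matrices is the maximum norm, hence the explicit
   Euclidean norm here and the explicit Lipschitz condition below. *)
Definition enorm n (x : 'cV[R]_n) : R := Num.sqrt (\sum_(i < n) x i 0 ^+ 2).

Definition hs_norm n (A : 'M[R]_n) : R :=
  Num.sqrt (\sum_(i < n) \sum_(j < n) A i j ^+ 2).

Definition op_norm n (A : 'M[R]_n) : R :=
  sup [set enorm (A *m x) | x in [set x : 'cV[R]_n | enorm x <= 1]].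

Definition lipschitz1 n (phi : 'cV[R]_n -> R) : Prop :=
  forall x y, `|phi x - phi y| <= enorm (x - y).

Definition quad_form n (A : 'M[R]_n) (x : 'cV[R]_n) : R := (x^T *m A *m x) 0 0.

End norms.

Section random_vectors.
Context d (T : measurableType d) (R : realType) (P : probability T R) (n : nat).
Implicit Types X : T -> 'cV[R]_n.

(* Measurability for the Borel sigma-algebra; the topology of 'cV[R]_n is the
   product topology, i.e. the Euclidean one. *)
Definition random_vector X : Prop :=
  measurable_fun [set: T] (X : T -> g_sigma_algebraType (@open 'cV[R]_n)).

Definition coord X (i : 'I_n) : T -> R := fun w => X w i 0.

Definition mean_zero X : Prop := forall i, ('E_P[coord X i] = 0)%E.

Definition cov_mx X : 'M[R]_n :=
  \matrix_(i, j) fine (covariance P (coord X i) (coord X j)).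

Definition convex_concentration X (K : R) : Prop :=
  forall phi : 'cV[R]_n -> R,
    convex_function [set: convex_lmodType 'cV[R]_n] phi -> lipschitz1 phi ->
    P.-integrable [set: T] (EFin \o (phi \o X)) /\
    forall t : R, 0 < t ->
      (P [set w | (t <= `|phi (X w) - fine 'E_P[phi \o X]%E|)%R]
       <= (2 * expR (- (t ^+ 2 / K ^+ 2)))%:E)%E.

End random_vectors.

(* Main.v *)
Require Import Defs.
From HB Require Import structures.
From mathcomp Require Import all_boot all_order all_algebra.
From mathcomp Require Import all_classical all_reals all_analysis.
From mathcomp Require Import measurable_realfun spectral complex ring lra.

Set Implicit Arguments.
Unset Strict Implicit.
Unset Printing Implicit Defensive.

Import Order.TTheory GRing.Theory Num.Theory.
Import numFieldNormedType.Exports.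

Local Open Scope classical_set_scope.
Local Open Scope ring_scope.

(** Since [x^T A x] only depends on the symmetric part [S] of [A], and
    [S = B - D] with [B], [D] positive semidefinite, symmetric and such that
    [|B x|, |D x| <= |S x|] ([sym_decomposition]), it is enough to bound the
    deviations of [Y = X^T B X] for positive [B].

    The function [x^T B x] is convex, and its gradient has norm [2 |B x|]. Now
    [|B X|] is itself a convex function of [X], with Lipschitz constant at most
    [a = op_norm A] and with mean at most
    [v = sqrt (hs_norm A ^ 2 * op_norm Cov)], because [E |S X|^2] is the trace of
    [S Cov S^T] ([second_moment_mulmx]). Hence the gradient is at most
    [2 M = 2 (v + q K a)] outside an event of probability [2 exp (- q^2)]. On the
    complement, the form agrees with a convex function that is [2 M]-Lipschitz
    everywhere ([convex_truncation]), and convex concentration shows that [Y]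
    deviates from some centre by more than [2 q K M] with probability at most
    [4 exp (- q^2)] ([psd_tail]). The two terms of
    [q K M = q K v + q^2 K^2 a] are the two regimes of the theorem.

    The centre is the mean of the truncated function and depends on [q].
    [recenter] replaces it by a centre [m] valid for all [q], and integrating the
    resulting tail bounds [|E Y - m|] by a multiple of [K v + K^2 a], which is
    small compared with [t] as soon as [q] exceeds a universal constant
    ([psd_tail_mean]). For smaller [q] the right-hand side of the theorem is at
    least 1 once [C] is large ([hanson_wright_scaled]).

    The second inequality amounts to [op_norm Cov <= 2 K^2]
    ([op_norm_cov_le]), which follows by integrating the tails of the linear
    forms of [X]. *)

(** * Euclidean norms, operator norms and the symmetric part *)

Section euclidean.
Context {R : realType}.

Definition dotv n (u x : 'cV[R]_n) : R := (u^T *m x) 0 0.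

Lemma dotvE n (u x : 'cV[R]_n) : dotv u x = \sum_i u i 0 * x i 0.
Proof. by rewrite /dotv mxE; apply: eq_bigr => i _; rewrite mxE. Qed.

Lemma dotvC n (u x : 'cV[R]_n) : dotv u x = dotv x u.
Proof. by rewrite !dotvE; apply: eq_bigr => i _; rewrite mulrC. Qed.

Lemma dotvDr n (u x y : 'cV[R]_n) : dotv u (x + y) = dotv u x + dotv u y.
Proof. by rewrite /dotv mulmxDr mxE. Qed.

Lemma dotvDl n (u x y : 'cV[R]_n) : dotv (x + y) u = dotv x u + dotv y u.
Proof. by rewrite dotvC dotvDr !(dotvC u). Qed.

Lemma dotvZr n (u x : 'cV[R]_n) a : dotv u (a *: x) = a * dotv u x.
Proof. by rewrite /dotv -scalemxAr mxE. Qed.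

Lemma dotvZl n (u x : 'cV[R]_n) a : dotv (a *: x) u = a * dotv x u.
Proof. by rewrite dotvC dotvZr dotvC. Qed.

Lemma dotvNr n (u x : 'cV[R]_n) : dotv u (- x) = - dotv u x.
Proof. by rewrite -scaleN1r dotvZr mulN1r. Qed.

Lemma dotvBr n (u x y : 'cV[R]_n) : dotv u (x - y) = dotv u x - dotv u y.
Proof. by rewrite dotvDr dotvNr. Qed.

Lemma dotvBl n (u x y : 'cV[R]_n) : dotv (x - y) u = dotv x u - dotv y u.
Proof. by rewrite dotvC dotvBr !(dotvC u). Qed.

Lemma dotv_mulmx m n (A : 'M[R]_(m, n)) u x :
  dotv u (A *m x) = dotv (A^T *m u) x.
Proof. by rewrite /dotv trmx_mul trmxK mulmxA. Qed.

Lemma enorm_ge0 n (x : 'cV[R]_n) : 0 <= enorm x.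
Proof. exact: sqrtr_ge0. Qed.

Lemma enorm_sqr n (x : 'cV[R]_n) : enorm x ^+ 2 = dotv x x.
Proof.
rewrite sqr_sqrtr; last by apply: sumr_ge0 => i _; exact: sqr_ge0.
by rewrite dotvE; apply: eq_bigr => i _; rewrite expr2.
Qed.

Lemma enorm_le n (x : 'cV[R]_n) (c : R) :
  0 <= c -> dotv x x <= c ^+ 2 -> enorm x <= c.
Proof.
by move=> c0 h; rewrite -(@ler_pXn2r _ 2) ?nnegrE ?enorm_ge0// enorm_sqr.
Qed.

Lemma enorm_eq0 n (x : 'cV[R]_n) : enorm x = 0 -> x = 0.
Proof.
move=> x0; apply/matrixP => i j; rewrite ord1 mxE; apply/eqP.
have : dotv x x = 0 by rewrite -enorm_sqr x0 expr0n.
rewrite dotvE => /eqP; rewrite psumr_eq0 => [/allP/(_ i)|k _].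
  by rewrite mem_index_enum /= mulf_eq0 orbb; apply.
by rewrite -expr2 sqr_ge0.
Qed.

Lemma enorm0 n : enorm (0 : 'cV[R]_n) = 0.
Proof.
apply/eqP; rewrite eq_le enorm_ge0 andbT; apply: enorm_le => //.
by rewrite /dotv mulmx0 mxE expr0n.
Qed.

Lemma enormZ n (x : 'cV[R]_n) a : enorm (a *: x) = `|a| * enorm x.
Proof.
apply/eqP; rewrite -(@eqrXn2 _ 2) ?mulr_ge0 ?enorm_ge0//.
by rewrite exprMn !enorm_sqr dotvZl dotvZr real_normK ?num_real// mulrA expr2.
Qed.

Lemma cauchy_schwarz n (u x : 'cV[R]_n) : dotv u x <= enorm u * enorm x.
Proof.
set a := enorm u; set b := enorm x.
have a0 : 0 <= a by exact: enorm_ge0.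
have b0 : 0 <= b by exact: enorm_ge0.
have [a_eq0|a_neq0] := eqVneq a 0.
  by rewrite (enorm_eq0 a_eq0) a_eq0 mul0r /dotv trmx0 mul0mx mxE.
have [b_eq0|b_neq0] := eqVneq b 0.
  by rewrite (enorm_eq0 b_eq0) b_eq0 mulr0 /dotv mulmx0 mxE.
have ab : 0 < a * b by rewrite mulr_gt0// lt_neqAle eq_sym ?a_neq0 ?b_neq0.
have : 0 <= dotv (b *: u - a *: x) (b *: u - a *: x).
  by rewrite -enorm_sqr sqr_ge0.
rewrite !dotvBl !dotvBr !dotvZl !dotvZr -!enorm_sqr -/a -/b (dotvC x u) => h.
rewrite -(ler_pM2l ab); nra.
Qed.

Lemma cauchy_schwarz_abs n (u x : 'cV[R]_n) :
  `|dotv u x| <= enorm u * enorm x.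
Proof.
rewrite ler_norml cauchy_schwarz andbT lerNl -dotvNr.
by rewrite (le_trans (cauchy_schwarz _ _))// -scaleN1r enormZ normrN1 mul1r.
Qed.

Lemma ler_enormD n (x y : 'cV[R]_n) : enorm (x + y) <= enorm x + enorm y.
Proof.
apply: enorm_le; first by rewrite addr_ge0 ?enorm_ge0.
rewrite dotvDl !dotvDr (dotvC y x) -!enorm_sqr.
by have := cauchy_schwarz x y; lra.
Qed.

Lemma enormN n (x : 'cV[R]_n) : enorm (- x) = enorm x.
Proof. by rewrite -scaleN1r enormZ normrN1 mul1r. Qed.

Lemma ler_enormB n (x y : 'cV[R]_n) : `|enorm x - enorm y| <= enorm (x - y).
Proof.
have h1 := ler_enormD (x - y) y; rewrite subrK in h1.
have h2 := ler_enormD (y - x) x; rewrite subrK -opprB enormN in h2.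
by rewrite ler_norml; apply/andP; split; lra.
Qed.

Lemma quad_formE n (A : 'M[R]_n) x : quad_form A x = dotv x (A *m x).
Proof. by rewrite /quad_form /dotv mulmxA. Qed.

Lemma hs_norm_sqr n (A : 'M[R]_n) :
  hs_norm A ^+ 2 = \sum_i \sum_j A i j ^+ 2.
Proof.
rewrite sqr_sqrtr//.
by apply: sumr_ge0 => i _; apply: sumr_ge0 => j _; exact: sqr_ge0.
Qed.

Lemma enorm_row_sqr n (A : 'M[R]_n) i :
  \sum_j A i j ^+ 2 = enorm (row i A)^T ^+ 2.
Proof. by rewrite enorm_sqr dotvE; apply: eq_bigr => j _; rewrite !mxE expr2. Qed.

Lemma enorm_mul_sqr n (A : 'M[R]_n) x :
  enorm (A *m x) ^+ 2 = \sum_i dotv (row i A)^T x ^+ 2.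
Proof.
rewrite enorm_sqr dotvE; apply: eq_bigr => i _.
by rewrite /dotv trmxK -row_mul -expr2; congr (_ ^+ 2); rewrite [RHS]mxE.
Qed.

Lemma enorm_hs n (A : 'M[R]_n) x : enorm (A *m x) <= hs_norm A * enorm x.
Proof.
apply: enorm_le; first by rewrite mulr_ge0 ?sqrtr_ge0.
rewrite -enorm_sqr enorm_mul_sqr exprMn hs_norm_sqr mulr_suml.
apply: ler_sum => i _; rewrite enorm_row_sqr -real_normK ?num_real// -exprMn.
by rewrite ler_pXn2r ?nnegrE ?mulr_ge0 ?enorm_ge0// cauchy_schwarz_abs.
Qed.

Lemma op_norm_has_sup n (A : 'M[R]_n) :
  has_sup [set enorm (A *m x) | x in [set x : 'cV[R]_n | enorm x <= 1]].
Proof.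
split; first by exists (enorm (A *m 0)); exists 0 => //=; rewrite enorm0.
exists (hs_norm A) => _ [x /= x1 <-]; apply: (le_trans (enorm_hs A x)).
by rewrite ler_piMr ?sqrtr_ge0.
Qed.

Lemma op_norm_ge0 n (A : 'M[R]_n) : 0 <= op_norm A.
Proof.
apply: (le_trans (enorm_ge0 (A *m 0))).
apply: sup_upper_bound; first exact: op_norm_has_sup.
by exists 0 => //=; rewrite enorm0.
Qed.

Lemma enorm_op n (A : 'M[R]_n) x : enorm (A *m x) <= op_norm A * enorm x.
Proof.
have [x_eq0|x_neq0] := eqVneq (enorm x) 0.
  by rewrite (enorm_eq0 x_eq0) mulmx0 enorm0 mulr0.
have x_gt0 : 0 < enorm x by rewrite lt_neqAle eq_sym x_neq0 enorm_ge0.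
rewrite -ler_pdivrMr// mulrC.
have -> : (enorm x)^-1 * enorm (A *m x) = enorm (A *m ((enorm x)^-1 *: x)).
  by rewrite -scalemxAr enormZ ger0_norm// invr_ge0 ltW.
apply: sup_upper_bound; first exact: op_norm_has_sup.
exists ((enorm x)^-1 *: x) => //=.
by rewrite enormZ ger0_norm ?invr_ge0 ?(ltW x_gt0)// mulVf ?gt_eqF.
Qed.

Lemma op_norm_le n (A : 'M[R]_n) (c : R) : 0 <= c ->
  (forall x, enorm (A *m x) <= c * enorm x) -> op_norm A <= c.
Proof.
move=> c0 h; apply: ge_sup; first by case: (op_norm_has_sup A).
by move=> _ [x /= x1 <-]; rewrite (le_trans (h x))// ler_piMr.
Qed.

Lemma op_norm_eq0 n (A : 'M[R]_n) : op_norm A = 0 -> A = 0.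
Proof.
move=> A0; apply/matrixP => i j.
have h : A *m delta_mx j (0 : 'I_1) = 0.
  apply: enorm_eq0; apply/eqP; rewrite eq_le enorm_ge0 andbT.
  by rewrite (le_trans (enorm_op _ _))// A0 mul0r.
by have /matrixP/(_ i 0) := h; rewrite -colE !mxE.
Qed.

Lemma enorm_op_tr n (A : 'M[R]_n) x : enorm (A^T *m x) <= op_norm A * enorm x.
Proof.
have [y_eq0|y_neq0] := eqVneq (enorm (A^T *m x)) 0.
  by rewrite y_eq0 mulr_ge0 ?op_norm_ge0 ?enorm_ge0.
have y_gt0 : 0 < enorm (A^T *m x) by rewrite lt_neqAle eq_sym y_neq0 enorm_ge0.
rewrite -(ler_pM2l y_gt0) -expr2 enorm_sqr -dotv_mulmx.
rewrite (le_trans (cauchy_schwarz _ _))// [leLHS]mulrC mulrCA mulrA.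
by rewrite ler_wpM2r ?enorm_ge0// enorm_op.
Qed.

Definition sym_part n (A : 'M[R]_n) : 'M[R]_n := 2^-1 *: (A + A^T).

Lemma sym_part_sym n (A : 'M[R]_n) : (sym_part A)^T = sym_part A.
Proof. by rewrite /sym_part linearZ /= linearD /= trmxK addrC. Qed.

Lemma quad_sym_part n (A : 'M[R]_n) x : quad_form (sym_part A) x = quad_form A x.
Proof.
rewrite !quad_formE /sym_part -scalemxAl dotvZr mulmxDl dotvDr.
by rewrite [dotv x (A^T *m x)]dotv_mulmx trmxK [dotv (A *m x) x]dotvC; lra.
Qed.

Lemma enorm_sym_part n (A : 'M[R]_n) x :
  enorm (sym_part A *m x) <= op_norm A * enorm x.
Proof.
rewrite /sym_part -scalemxAl mulmxDl enormZ ger0_norm//.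
have := ler_enormD (A *m x) (A^T *m x).
by have := enorm_op A x; have := enorm_op_tr A x; lra.
Qed.

Lemma hs_sym_part n (A : 'M[R]_n) : hs_norm (sym_part A) ^+ 2 <= hs_norm A ^+ 2.
Proof.
rewrite !hs_norm_sqr.
have -> : \sum_i \sum_j A i j ^+ 2 =
    \sum_i \sum_j (A i j ^+ 2 + A j i ^+ 2) / 2.
  transitivity ((\sum_i \sum_j A i j ^+ 2 + \sum_i \sum_j A j i ^+ 2) / 2).
    by rewrite [X in _ + X]exchange_big /=; lra.
  rewrite -big_split /= mulr_suml; apply: eq_bigr => i _.
  by rewrite -big_split /= mulr_suml.
apply: ler_sum => i _; apply: ler_sum => j _; rewrite !mxE.
by have := sqr_ge0 (A i j - A j i); nra.
Qed.

(** For unit [x] and [y = S x / |S x|], polarization gives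
    [2 |S x| = 2 y^T S x <= y^T S y + x^T S x]; the proof is the homogeneous
    form of this, obtained by expanding the form at [|x| S x - |S x| x]. *)
Lemma psd_op_norm_le n (S : 'M[R]_n) (k : R) : 0 <= k -> S^T = S ->
  (forall u, 0 <= quad_form S u <= k * enorm u ^+ 2) -> op_norm S <= k.
Proof.
move=> k0 Ssym Sq; apply: op_norm_le => // x.
set y := S *m x; set a := enorm y; set b := enorm x.
have [a0|a_neq0] := eqVneq a 0; first by rewrite a0 mulr_ge0 ?enorm_ge0.
have a_gt0 : 0 < a by rewrite lt_neqAle eq_sym a_neq0 enorm_ge0.
have b_gt0 : 0 < b.
  rewrite lt_neqAle enorm_ge0 eq_sym andbT; apply: contra_neq a_neq0 => /enorm_eq0.
  by rewrite /a /y => ->; rewrite mulmx0 enorm0.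
have /andP[+ _] := Sq (b *: y - a *: x).
have /andP[_] := Sq y; have /andP[_] := Sq x.
rewrite !quad_formE -/a -/b => qx qy.
rewrite mulmxBr -!scalemxAr !dotvBr !dotvBl !dotvZl !dotvZr -/y.
have -> : dotv x (S *m y) = a ^+ 2 by rewrite dotv_mulmx Ssym enorm_sqr.
rewrite -enorm_sqr -/a => h.
have h2 : 2 * a ^+ 2 * (a * b) <= 2 * (k * b * a) * (a * b).
  have h3 := ler_wpM2l (sqr_ge0 b) qy; have h4 := ler_wpM2l (sqr_ge0 a) qx.
  by nra.
have ab : 0 < a * b by rewrite mulr_gt0.
rewrite ler_pM2r// in h2; rewrite -(ler_pM2r a_gt0); nra.
Qed.

End euclidean.

(** * Positive and negative parts of a real symmetric matrix *)

Section spectral_real.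
Context {R : realType}.
Local Notation C := (R[i]%C : numClosedFieldType).

Let ReS (I : finType) (F : I -> R[i]%C) :
  complex.Re (\sum_i F i) = \sum_i complex.Re (F i).
Proof. by apply: (big_morph (@complex.Re R)) => // -[a b] [c d]. Qed.

Let ImS (I : finType) (F : I -> R[i]%C) :
  complex.Im (\sum_i F i) = \sum_i complex.Im (F i).
Proof. by apply: (big_morph (@complex.Im R)) => // -[a b] [c d]. Qed.

(** The spectral theorem for [A] seen as a complex Hermitian matrix gives a
    unitary [P] with [P A = diag d P] and [d] real. Stacking the real and the
    imaginary part of [P] gives a real matrix that is only an isometry, with
    twice as many rows as columns, but still intertwines [A] with a real
    diagonal matrix: this is all that functional calculus on [A] requires, and
    it spares the choice of a real eigenbasis. *)
Lemma real_spectral n (A : 'M[R]_n) : A^T = A ->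
  exists (U : 'M[R]_(n + n, n)) (d : 'rV[R]_(n + n)),
    U^T *m U = 1%:M /\ U *m A = diag_mx d *m U.
Proof.
move=> Asym; pose Ac : 'M[C]_n := map_mx (real_complex R) A.
have Ah : Ac \is hermsymmx.
  apply/is_hermitianmxP; rewrite expr0 scale1r.
  by apply/matrixP => i j; rewrite !mxE -{1}Asym mxE; apply/esym/conjc_real.
have /orthomx_spectralP Aeq := hermitian_normalmx Ah.
have /mxOverP Dreal := hermitian_spectral_diag_real Ah.
have Pu := spectral_unitarymx Ac.
set P := spectralmx Ac in Aeq Pu; set D := spectral_diag Ac in Aeq Dreal.
have PA : P *m Ac = diag_mx D *m P.
  by rewrite {1}Aeq !mulmxA mulmxV ?mul1mx// unitarymx_unit.
have PP : invmx P *m P = 1%:M by rewrite mulVmx// unitarymx_unit.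
rewrite invmx_unitary// in PP.
pose dr i := complex.Re (D 0 i).
have DE i : D 0 i = (dr i)%:C%C by rewrite /dr RRe_real.
pose U := col_mx (map_mx (@complex.Re R) P) (map_mx (@complex.Im R) P).
pose dd : 'rV[R]_n := \row_i dr i.
exists U, (row_mx dd dd); split.
  rewrite tr_col_mx mul_row_col; apply/matrixP => i j.
  move/matrixP/(_ i j) : PP; rewrite !mxE => /(congr1 (@complex.Re R)).
  rewrite ReS -big_split /= => h.
  transitivity (complex.Re ((i == j)%:R : R[i]%C)); last by case: (i == j).
  rewrite -h; apply: eq_bigr => k _; rewrite !mxE.
  case: (P k i) => a b; case: (P k j) => e f /=.
  by rewrite mulNr opprK.
have PAij i j : \sum_k P i k * (A k j)%:C%C = (dr i)%:C%C * P i j.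
  move/matrixP/(_ i j) : PA; rewrite mul_diag_mx mxE [RHS]mxE DE => <-.
  by apply: eq_bigr => k _; rewrite !mxE.
rewrite mul_col_mx; apply/matrixP => i j; rewrite mul_diag_mx [RHS]mxE.
case: (split_ordP i) => k ->.
  rewrite !col_mxEu row_mxEl !mxE.
  have := PAij k j => /(congr1 (@complex.Re R)); rewrite ReS => h.
  transitivity (complex.Re ((dr k)%:C%C * P k j)).
    rewrite -h; apply: eq_bigr => l _; rewrite !mxE.
    by case: (P k l) => a b /=; rewrite mulr0 subr0.
  by case: (P k j) => a b /=; rewrite mul0r subr0.
rewrite !col_mxEd row_mxEr !mxE.
have := PAij k j => /(congr1 (@complex.Im R)); rewrite ImS => h.
transitivity (complex.Im ((dr k)%:C%C * P k j)).
  rewrite -h; apply: eq_bigr => l _; rewrite !mxE.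
  by case: (P k l) => a b /=; rewrite mulr0 add0r.
by case: (P k j) => a b /=; rewrite mul0r addr0.
Qed.

(** [B = U^T d^+ U] and [D = U^T d^- U] with [U], [d] as in [real_spectral]. The
    pointwise domination by [|A x|] is what controls at the same time the
    operator norms and the second moments of [B X] and [D X] by those of [A X].
    It holds because [U^T] is a contraction, [|d^+|, |d^-| <= |d|] entrywise and
    [|diag d U x| = |U A x| = |A x|]. *)
Lemma sym_decomposition n (A : 'M[R]_n) : A^T = A ->
  exists B D : 'M[R]_n, [/\ A = B - D, B^T = B /\ D^T = D,
    forall x, 0 <= quad_form B x /\ 0 <= quad_form D x &
    forall x, enorm (B *m x) <= enorm (A *m x) /\
              enorm (D *m x) <= enorm (A *m x)].
Proof.
move=> /real_spectral[U [d [UU UA]]].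
have iso x : dotv (U *m x) (U *m x) = dotv x x.
  by rewrite dotv_mulmx mulmxA UU mul1mx.
have contr z : dotv (U^T *m z) (U^T *m z) <= dotv z z.
  have h : 0 <= dotv (z - U *m (U^T *m z)) (z - U *m (U^T *m z)).
    by rewrite -enorm_sqr sqr_ge0.
  have e : dotv z (U *m (U^T *m z)) = dotv (U^T *m z) (U^T *m z).
    by rewrite dotv_mulmx.
  by move: h; rewrite dotvBl !dotvBr iso [dotv (U *m _) z]dotvC e; lra.
pose part (f : R -> R) := U^T *m (diag_mx (map_mx f d) *m U).
have part_sym f : (part f)^T = part f.
  by rewrite /part !trmx_mul trmxK tr_diag_mx mulmxA.
have part_quad f x : (forall y, 0 <= f y) -> 0 <= quad_form (part f) x.
  move=> f0; rewrite quad_formE -mulmxA -mulmxA dotv_mulmx trmxK dotvE.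
  move: (U *m x) => y.
  apply: sumr_ge0 => i _; rewrite mul_diag_mx !mxE mulrCA -expr2.
  by rewrite mulr_ge0 ?sqr_ge0.
have part_le f x : (forall y, `|f y| <= `|y|) ->
    enorm (part f *m x) <= enorm (A *m x).
  move=> fle; apply: enorm_le; first exact: enorm_ge0.
  rewrite -!mulmxA enorm_sqr (le_trans (contr _))// -[leRHS]iso.
  rewrite [U *m (A *m x)]mulmxA UA -mulmxA !dotvE.
  move: (U *m x) => y; apply: ler_sum => i _.
  rewrite !mul_diag_mx !mxE mulrACA [leRHS]mulrACA ler_wpM2r//.
    by rewrite -expr2 sqr_ge0.
  by rewrite -!expr2 -[leLHS]real_normK ?num_real// -[leRHS]real_normK ?num_real//
    ler_pXn2r ?nnegrE.
exists (part (Num.max 0)), (part (fun y => Num.max 0 (- y))); split.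
- rewrite /part -mulmxBr -mulmxBl -linearB /=.
  have -> : map_mx (Num.max 0) d - map_mx (fun y => Num.max 0 (- y)) d = d.
    apply/matrixP => i j; rewrite !mxE.
    by have [] := leP 0 (d i j); have [] := leP 0 (- d i j); lra.
  by rewrite -UA mulmxA UU mul1mx.
- by rewrite !part_sym.
- by move=> x; rewrite !part_quad// => y; rewrite le_max lexx.
- move=> x; split; apply: part_le => y.
    by have [y0|y0] := leP 0 y; rewrite ?normr0 ?normr_ge0.
  by have [y0|y0] := leP 0 (- y); rewrite ?normr0 ?normr_ge0 ?normrN.
Qed.

End spectral_real.

(** * Convex Lipschitz truncation of a positive quadratic form *)

Section truncation.
Context {R : realType}.

Definition lipschitz n (L : R) (phi : 'cV[R]_n -> R) : Prop :=
  forall x y, `|phi x - phi y| <= L * enorm (x - y).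

Definition cvx n (phi : 'cV[R]_n -> R) : Prop :=
  forall x y s, 0 <= s -> s <= 1 ->
    phi (s *: x + (1 - s) *: y) <= s * phi x + (1 - s) * phi y.

Lemma cvx_convex_function n (phi : 'cV[R]_n -> R) : cvx phi ->
  convex_function [set: convex_lmodType 'cV[R]_n] phi.
Proof.
by move=> h t x y _ _; apply: h; [exact: ge0 | exact: le1].
Qed.

Lemma cvx_dotv n (u : 'cV[R]_n) : cvx (dotv u).
Proof. by move=> x y s _ _; rewrite dotvDr !dotvZr. Qed.

Lemma lipschitz_dotv n (u : 'cV[R]_n) : lipschitz (enorm u) (dotv u).
Proof. by move=> x y; rewrite -dotvBr cauchy_schwarz_abs. Qed.

Lemma cvx_enorm_mul n (B : 'M[R]_n) : cvx (fun x => enorm (B *m x)).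
Proof.
move=> x y s s0 s1; rewrite mulmxDr -!scalemxAr (le_trans (ler_enormD _ _))//.
by rewrite !enormZ !ger0_norm// subr_ge0.
Qed.

Lemma lipschitz_enorm_mul n (B : 'M[R]_n) (a : R) :
  (forall x, enorm (B *m x) <= a * enorm x) ->
  lipschitz a (fun x => enorm (B *m x)).
Proof.
by move=> h x y; rewrite (le_trans (ler_enormB _ _))// -mulmxBr.
Qed.

(** The gradient [2 B x] of the convex function [x^T B x] is unbounded unless
    [B = 0], so the form itself is not Lipschitz. The supremum of its tangents at the points
    with [|B y| <= M] only retains slopes of norm at most [2 M]; it remains
    convex and has the same value as the form wherever [|B x| <= M]. *)
Lemma convex_truncation n (B : 'M[R]_n) (M : R) :
  B^T = B -> (forall x, 0 <= quad_form B x) -> 0 <= M ->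
  exists phi : 'cV[R]_n -> R, [/\ cvx phi, lipschitz (2 * M) phi &
    forall x, enorm (B *m x) <= M -> phi x = quad_form B x].
Proof.
move=> Bsym Bpsd M0.
pose tangent x y := 2 * dotv (B *m y) x - quad_form B y.
pose S x := [set tangent x y | y in [set y | enorm (B *m y) <= M]].
pose phi x := sup (S x).
have tangent_le x y : tangent x y <= quad_form B x.
  have := Bpsd (x - y); rewrite /tangent !quad_formE mulmxBr dotvBr !dotvBl.
  rewrite [dotv y (B *m x)]dotvC [dotv (B *m x) y]dotvC.
  have -> : dotv y (B *m x) = dotv (B *m y) x by rewrite dotv_mulmx Bsym.
  by rewrite [dotv x (B *m y)]dotvC; lra.
have Ssup x : has_sup (S x).
  split; first by exists (tangent x 0); exists 0 => //=; rewrite mulmx0 enorm0.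
  by exists (quad_form B x) => _ [y _ <-].
have phi_ub x y : enorm (B *m y) <= M -> tangent x y <= phi x.
  by move=> yM; apply: sup_upper_bound; [exact: Ssup | exists y].
have phi_lub x c : (forall y, enorm (B *m y) <= M -> tangent x y <= c) ->
    phi x <= c.
  move=> h; apply: ge_sup; first by case: (Ssup x).
  by move=> _ [y yM <-]; apply: h.
exists phi; split.
- move=> x y s s0 s1; apply: phi_lub => z zM.
  have := phi_ub x z zM; have := phi_ub y z zM.
  rewrite /tangent dotvDr !dotvZr => h1 h2.
  have h3 : 0 <= 1 - s by rewrite subr_ge0.
  by have := ler_wpM2l s0 h2; have := ler_wpM2l h3 h1; lra.
- have lip x y : phi x - phi y <= 2 * M * enorm (x - y).
    rewrite lerBlDr; apply: phi_lub => z zM.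
    have -> : tangent x z = 2 * dotv (B *m z) (x - y) + tangent y z.
      by rewrite /tangent dotvBr; lra.
    rewrite lerD ?phi_ub// -mulrA ler_pM2l//.
    by rewrite (le_trans (cauchy_schwarz _ _))// ler_wpM2r ?enorm_ge0.
  move=> x y; rewrite ler_norml lip andbT lerNl opprB.
  by rewrite -[enorm (x - y)]enormN opprB.
- move=> x xM; apply/eqP; rewrite eq_le phi_lub//=.
  apply: le_trans (phi_ub x x xM); rewrite /tangent !quad_formE.
  by rewrite [dotv (B *m x) x]dotvC; lra.
Qed.

End truncation.

(** * Expectations and tails *)

Section expectation.
Context d (T : measurableType d) (R : realType) (P : probability T R).
Implicit Types f g : T -> R.

Definition intg f : Prop := P.-integrable [set: T] (EFin \o f).
Definition Ex f : R := \int[P]_w f w.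

Lemma fine_expectation f : fine ('E_P[f])%E = Ex f.
Proof. by rewrite unlock. Qed.

Lemma intg_measurable f : intg f -> measurable_fun [set: T] f.
Proof. by move=> /(measurable_int P)/measurable_EFinP. Qed.

Lemma intgZ k f : intg f -> intg (fun w => k * f w).
Proof. exact: integrableZl. Qed.

Lemma intgB f g : intg f -> intg g -> intg (fun w => f w - g w).
Proof. exact: integrableB. Qed.

Lemma intg_cst k : intg (fun=> k).
Proof. exact: finite_measure_integrable_cst. Qed.

Lemma intg_sum (I : finType) (F : I -> T -> R) :
  (forall i, intg (F i)) -> intg (fun w => \sum_i F i w).
Proof.
move=> h; rewrite /intg.
rewrite (_ : EFin \o _ = fun w => \sum_i (EFin \o F i) w)%E; last first.
  by apply/funext => w /=; rewrite sumEFin.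
by apply: integrable_sum => // i _; exact: h.
Qed.

Lemma ExD f g : intg f -> intg g -> Ex (fun w => f w + g w) = Ex f + Ex g.
Proof. by move=> *; exact: RintegralD. Qed.

Lemma ExB f g : intg f -> intg g -> Ex (fun w => f w - g w) = Ex f - Ex g.
Proof. by move=> *; exact: RintegralB. Qed.

Lemma ExZ k f : intg f -> Ex (fun w => k * f w) = k * Ex f.
Proof. by move=> *; exact: RintegralZl. Qed.

Lemma Ex_cst k : Ex (fun=> k) = k.
Proof.
by rewrite -fine_expectation -[fun=> k]/(cst k) expectation_cst.
Qed.

Lemma Ex_sum (I : finType) (F : I -> T -> R) :
  (forall i, intg (F i)) -> Ex (fun w => \sum_i F i w) = \sum_i Ex (F i).
Proof.
move=> h; rewrite /Ex.
elim: (index_enum I) => [|i s IH].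
  rewrite big_nil -[RHS](Ex_cst 0).
  by apply: eq_Rintegral => w _; rewrite big_nil.
under eq_Rintegral do rewrite big_cons.
rewrite big_cons -IH RintegralD//; first exact: h.
rewrite (_ : EFin \o _ = fun w => \sum_(j <- s) (EFin \o F j) w)%E; last first.
  by apply/funext => w /=; rewrite sumEFin.
by apply: integrable_sum => // j _; exact: h.
Qed.

Lemma Ex_le f g : intg f -> intg g -> (forall w, f w <= g w) -> Ex f <= Ex g.
Proof. by move=> ? ? h; apply: le_Rintegral => // w _; exact: h. Qed.

Lemma Ex_ge0 f : (forall w, 0 <= f w) -> 0 <= Ex f.
Proof. by move=> h; apply: Rintegral_ge0. Qed.

Lemma Ex_dist f c : intg f -> `|Ex f - c| <= Ex (fun w => `|f w - c|).
Proof.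
move=> fi; have fc : intg (fun w => f w - c) by apply: intgB (intg_cst c).
rewrite -[in leLHS](Ex_cst c) -ExB//; last exact: intg_cst.
exact: le_normr_Rintegral.
Qed.

Lemma Ex_sqr_le f : intg f -> intg (fun w => f w ^+ 2) ->
  Ex f ^+ 2 <= Ex (fun w => f w ^+ 2).
Proof.
move=> fi f2i; set m := Ex f.
have : 0 <= Ex (fun w => f w ^+ 2 - 2 * m * f w + m ^+ 2).
  apply: Ex_ge0 => w.
  by rewrite (_ : _ + _ = (f w - m) ^+ 2) ?sqr_ge0//; ring.
have i1 : intg (fun w => 2 * m * f w) by exact: intgZ.
have i2 : intg (fun w => f w ^+ 2 - 2 * m * f w) by exact: intgB.
rewrite (ExD i2 (intg_cst _)) (ExB f2i i1) (ExZ _ fi) Ex_cst.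
by rewrite -/m; lra.
Qed.

Lemma measurable_gt f s : measurable_fun [set: T] f -> measurable [set w | s < f w].
Proof.
move=> mf; have -> : [set w | s < f w] = f @^-1` `]s, +oo[.
  by apply/seteqP; split => w /=; rewrite in_itv/= andbT.
by rewrite -[X in measurable X]setTI; apply: mf.
Qed.

Lemma measurable_ge_dist f c s : measurable_fun [set: T] f ->
  measurable [set w | s <= `|f w - c|].
Proof.
move=> mf.
have -> : [set w | s <= `|f w - c|] = (fun w => `|f w - c|) @^-1` `[s, +oo[.
  by apply/seteqP; split => w /=; rewrite in_itv/= andbT.
rewrite -[X in measurable X]setTI.
have mg : measurable_fun [set: T] (fun w => `|f w - c|).
  by apply: measurableT_comp => //; apply: measurable_funB.
exact: mg.
Qed.

Lemma tail_integral (a c : R) : 0 < c ->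
  (\int[lebesgue_measure]_(s in `[0%R, +oo[) (a * expR (- (s / c)))%:E =
   (a * c)%:E)%E.
Proof.
move=> c0; have ic0 : 0 < c^-1 by rewrite invr_gt0.
have h := integral_exponential_pdf ic0.
transitivity ((a * c)%:E *
    \int[lebesgue_measure]_x (exponential_pdf c^-1 x)%:E)%E; last first.
  by rewrite h mule1.
rewrite -integralZl//; last exact: integrable_exponential_pdf.
rewrite [LHS]integral_mkcond; apply: eq_integral => x _.
rewrite /exponential_pdf !patchE; case: ifP => _ /=; last by rewrite mule0.
rewrite -EFinM; congr EFin.
rewrite -[in RHS]mulrA mulVKf ?gt_eqF// [- c^-1 * x]mulrC mulrN.
by [].
Qed.

(** Layer cake. The constants are sharp, so that a tail [2 exp (- s / c)] yields
    exactly [2 c]: the second inequality of the theorem has no slack in its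
    factor 2. *)
Lemma tail_expectation f (a c : R) : measurable_fun [set: T] f ->
  (forall w, 0 <= f w) -> 0 < c -> 1 <= a ->
  (forall s, 0 < s -> (P [set w | (s < f w)%R] <= (a * expR (- (s / c)))%:E)%E) ->
  intg f /\ Ex f <= a * c.
Proof.
move=> mf f0 c0 a1 tail.
pose Y : {RV P >-> R} := mfun_Sub (mem_set mf).
have le : (\int[P]_w (f w)%:E <= (a * c)%:E)%E.
  have := @ge0_expectation_ccdf _ _ _ P Y f0.
  rewrite expectation_def /= => ->; rewrite -tail_integral//.
  apply: ge0_le_integral => //=.
  - by apply: measurable_funTS; exact: ccdf_measurable.
  - apply/measurable_EFinP; apply: measurable_funM => //.
    by apply: measurableT_comp => //; apply: measurableT_comp => //;
      apply: measurable_funM.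
  - move=> s; rewrite in_itv/= andbT le_eqVlt => /predU1P[<-|s0].
      rewrite mul0r oppr0 expR0 mulr1.
      by rewrite (le_trans (probability_le1 _ _))// lee_fin.
    have -> : ccdf Y s = P [set w | (s < f w)%R].
      rewrite /ccdf /distribution /pushforward; congr (P _).
      by apply/seteqP; split => w /=; rewrite in_itv/= andbT.
    exact: tail.
have fi : intg f.
  apply/integrableP; split; first exact/measurable_EFinP.
  rewrite (eq_integral (fun w => (f w)%:E)) ?(le_lt_trans le) ?ltry//.
  by move=> w _ /=; rewrite ger0_norm.
split=> //; rewrite -lee_fin (le_trans _ le)// /Ex /Rintegral fineK//.
exact: integrable_fin_num.
Qed.

End expectation.

(** * Moments under convex concentration *)

Section concentration.
Context d (T : measurableType d) (R : realType) (P : probability T R) (n : nat).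
Variables (X : T -> 'cV[R]_n) (K : R).
Hypotheses (K0 : 0 < K) (X0 : mean_zero P X) (XK : convex_concentration P X K).
Local Notation Ex := (Ex P).
Local Notation intg := (intg P).

(** The concentration property at the 1-Lipschitz function [phi / L]. *)
Lemma lipschitz_concentration (phi : 'cV[R]_n -> R) (L : R) :
  0 < L -> cvx phi -> lipschitz L phi ->
  intg (fun w => phi (X w)) /\ forall t, 0 < t ->
    (P [set w | (t <= `|phi (X w) - Ex (fun w => phi (X w))|)%R]
      <= (2 * expR (- (t ^+ 2 / (K * L) ^+ 2)))%:E)%E.
Proof.
move=> L0 phic phil; pose psi x := L^-1 * phi x.
have iL0 : 0 < L^-1 by rewrite invr_gt0.
have psic : cvx psi.
  move=> x y s s0 s1; rewrite /psi (mulrCA s) (mulrCA (1 - s)) -mulrDr ler_pM2l//.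
  exact: phic.
have psil : lipschitz1 psi.
  move=> x y; rewrite /psi -mulrBr normrM gtr0_norm// ler_pdivrMl//.
have [psii psiP] := XK (cvx_convex_function psic) psil.
have phiE : (fun w => phi (X w)) = (fun w => L * psi (X w)).
  by apply/funext => w; rewrite /psi mulVKf// gt_eqF.
have ExE : Ex (fun w => phi (X w)) = L * Ex (fun w => psi (X w)).
  by rewrite phiE (ExZ L).
split; first by rewrite phiE; apply: intgZ.
move=> t t0; rewrite ExE.
have := psiP (t / L) (divr_gt0 t0 L0); rewrite fine_expectation.
have -> : (t / L) ^+ 2 / K ^+ 2 = t ^+ 2 / (K * L) ^+ 2.
  by field; rewrite !gt_eqF.
apply: le_trans; rewrite le_eqVlt; apply/orP; left; apply/eqP.
congr (P _); apply/seteqP; split => w /=.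
  rewrite -[phi (X w)](mulVKf (lt0r_neq0 L0)) -/(psi _) -mulrBr normrM gtr0_norm//.
  by rewrite ler_pdivrMr// mulrC.
rewrite -[phi (X w)](mulVKf (lt0r_neq0 L0)) -/(psi _) -mulrBr normrM gtr0_norm//.
by rewrite ler_pdivrMr// [_ * L]mulrC.
Qed.

Lemma intg_dotv u : intg (fun w => dotv u (X w)).
Proof.
have [u0|u_neq0] := eqVneq (enorm u) 0.
  rewrite (enorm_eq0 u0) (_ : (fun w => _) = (fun=> 0)); first exact: intg_cst.
  by apply/funext => w; rewrite /dotv trmx0 mul0mx mxE.
have u_gt0 : 0 < enorm u by rewrite lt_neqAle eq_sym u_neq0 enorm_ge0.
by have [] := lipschitz_concentration u_gt0 (cvx_dotv u) (lipschitz_dotv u).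
Qed.

Lemma coordE i : Defs.coord X i = fun w => dotv (delta_mx i 0) (X w).
Proof.
by apply/funext => w; rewrite /Defs.coord /dotv trmx_delta -rowE mxE.
Qed.

Lemma Ex_dotv u : Ex (fun w => dotv u (X w)) = 0.
Proof.
have ci i : intg (Defs.coord X i) by rewrite coordE; exact: intg_dotv.
rewrite (_ : (fun w => _) = (fun w => \sum_i u i 0 * Defs.coord X i w)); last first.
  by apply/funext => w; rewrite dotvE.
rewrite Ex_sum => [|i]; last exact: intgZ.
rewrite big1// => i _; rewrite ExZ// -fine_expectation X0/= mulr0//.
Qed.

Lemma second_moment_dotv u :
  intg (fun w => dotv u (X w) ^+ 2) /\
  Ex (fun w => dotv u (X w) ^+ 2) <= 2 * K ^+ 2 * enorm u ^+ 2.
Proof.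
have [u0|u_neq0] := eqVneq (enorm u) 0.
  rewrite u0 expr0n mulr0 (enorm_eq0 u0) (_ : (fun w => _) = (fun=> 0)).
    by split; [exact: intg_cst | rewrite Ex_cst].
  by apply/funext => w; rewrite /dotv trmx0 mul0mx mxE expr0n.
have u_gt0 : 0 < enorm u by rewrite lt_neqAle eq_sym u_neq0 enorm_ge0.
have [ui uP] := lipschitz_concentration u_gt0 (cvx_dotv u) (lipschitz_dotv u).
have mu := intg_measurable ui.
have Ku0 : 0 < (K * enorm u) ^+ 2 by rewrite exprn_gt0// mulr_gt0.
rewrite -mulrA -exprMn; apply: tail_expectation => //.
- exact: measurable_funX.
- by move=> w; exact: sqr_ge0.
- by rewrite ler1n.
move=> s s0; have rs0 : 0 < Num.sqrt s by rewrite sqrtr_gt0.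
have := uP _ rs0; rewrite (sqr_sqrtr (ltW s0)); apply: le_trans.
rewrite Ex_dotv; apply: le_measure; rewrite ?inE.
- by apply: measurable_gt; exact: measurable_funX.
- exact: measurable_ge_dist.
move=> w /=; rewrite subr0 => /ltW sw.
by rewrite -sqrtr_sqr ler_wsqrtr.
Qed.

(** By polarization the product is a combination of squares of linear forms. *)
Lemma intg_dotvM u v : intg (fun w => dotv u (X w) * dotv v (X w)).
Proof.
rewrite (_ : (fun w => _) = (fun w =>
    4^-1 * (dotv (u + v) (X w) ^+ 2 - dotv (u - v) (X w) ^+ 2))).
  by apply: intgZ; apply: intgB; apply: (second_moment_dotv _).1.
by apply/funext => w; rewrite dotvDl dotvBl; field.
Qed.

Lemma cov_mxE i j :
  cov_mx P X i j = Ex (fun w => Defs.coord X i w * Defs.coord X j w).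
Proof.
rewrite mxE unlock fine_expectation /Ex; apply: eq_Rintegral => w _.
rewrite !X0 /=.
by rewrite -[LHS]/((Defs.coord X i w - 0) * (Defs.coord X j w - 0)) !subr0.
Qed.

Lemma cov_mx_sym : (cov_mx P X)^T = cov_mx P X.
Proof.
apply/matrixP => i j; rewrite mxE !cov_mxE; congr Ex.
by apply/funext => w; rewrite mulrC.
Qed.

Lemma quad_cov_mx u :
  quad_form (cov_mx P X) u = Ex (fun w => dotv u (X w) ^+ 2).
Proof.
have cM i j : intg (fun w => Defs.coord X i w * Defs.coord X j w).
  by rewrite !coordE; exact: intg_dotvM.
rewrite (_ : (fun w => _) = (fun w => \sum_i \sum_j
    (u i 0 * u j 0) * (Defs.coord X i w * Defs.coord X j w))); last first.
  apply/funext => w; rewrite expr2 !dotvE mulr_suml; apply: eq_bigr => i _.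
  by rewrite mulr_sumr; apply: eq_bigr => j _; rewrite mulrACA.
rewrite Ex_sum => [|i]; last by apply: intg_sum => j; apply: intgZ; exact: cM.
rewrite quad_formE dotvE; apply: eq_bigr => i _.
rewrite Ex_sum => [|j]; last by apply: intgZ; exact: cM.
rewrite mxE mulr_sumr; apply: eq_bigr => j _.
by rewrite ExZ; [rewrite -cov_mxE; ring | exact: cM].
Qed.

Lemma op_norm_cov_le : op_norm (cov_mx P X) <= 2 * K ^+ 2.
Proof.
apply: psd_op_norm_le; [by rewrite mulr_ge0 ?sqr_ge0 | exact: cov_mx_sym |].
move=> u; rewrite quad_cov_mx; have [_ ->] := second_moment_dotv u.
by rewrite andbT; apply: Ex_ge0 => w; exact: sqr_ge0.
Qed.

(** The left-hand side is the trace of [S Cov S^T], the sum of the values of the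
    covariance form at the rows of [S]. *)
Lemma second_moment_mulmx (S : 'M[R]_n) :
  intg (fun w => enorm (S *m X w) ^+ 2) /\
  Ex (fun w => enorm (S *m X w) ^+ 2) <=
    hs_norm S ^+ 2 * op_norm (cov_mx P X).
Proof.
have E : (fun w => enorm (S *m X w) ^+ 2) =
    (fun w => \sum_i dotv (row i S)^T (X w) ^+ 2).
  by apply/funext => w; rewrite enorm_mul_sqr.
rewrite E; split; first by apply: intg_sum => i; exact: (second_moment_dotv _).1.
rewrite Ex_sum => [|i]; last exact: (second_moment_dotv _).1.
rewrite hs_norm_sqr mulr_suml; apply: ler_sum => i _.
rewrite -quad_cov_mx quad_formE (le_trans (cauchy_schwarz _ _))//.
by rewrite enorm_row_sqr expr2 -mulrA ler_wpM2l ?enorm_ge0// mulrC enorm_op.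
Qed.

Lemma intg_quad_form (A : 'M[R]_n) : intg (fun w => quad_form A (X w)).
Proof.
rewrite (_ : (fun w => _) = (fun w =>
    \sum_i dotv (delta_mx i 0) (X w) * dotv (row i A)^T (X w))); last first.
  apply/funext => w; rewrite quad_formE dotvE; apply: eq_bigr => i _.
  rewrite -(congr1 (fun f => f w) (coordE i)) /Defs.coord; congr (_ * _).
  by rewrite /dotv trmxK -row_mul [RHS]mxE.
by apply: intg_sum => i; exact: intg_dotvM.
Qed.

End concentration.

(** * Tails of a positive quadratic form *)

Section recentering.
Context d (T : measurableType d) (R : realType) (P : probability T R).

Lemma prob_sub_union (A B C : set T) (a b : R) :
  measurable A -> measurable B -> measurable C -> A `<=` B `|` C ->
  (P B <= a%:E)%E -> (P C <= b%:E)%E -> (P A <= (a + b)%:E)%E.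
Proof.
move=> mA mB mC ABC Ba Cb; rewrite EFinD (le_trans _ (leeD Ba Cb))//.
apply: le_trans (measureU2 P mB mC).
by apply: le_measure; rewrite ?inE//; exact: measurableU.
Qed.

Lemma prob_sub (A B : set T) (b : \bar R) :
  measurable A -> measurable B -> A `<=` B -> (P B <= b)%E -> (P A <= b)%E.
Proof. by move=> mA mB AB; apply: le_trans; apply: le_measure; rewrite ?inE. Qed.

(** A tail bound whose centre depends on the level can be stated with one centre.
    At the level 3 and at any other level the exceptional events together have
    probability less than 1, so some outcome avoids both of them and its value
    of [Y] is close to both centres. *)
Lemma recenter (Y : T -> R) (U : R -> R) :
  measurable_fun [set: T] Y ->
  (forall q : R, (3 <= q)%R -> (U 3 <= U q)%R) ->
  (forall q : R, (3 <= q)%R -> exists c,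
    (P [set w | (U q <= `|Y w - c|)%R] <= (4 * expR (- q ^+ 2))%:E)%E) ->
  exists m, forall q : R, (3 <= q)%R ->
    (P [set w | (3 * U q <= `|Y w - m|)%R] <= (4 * expR (- q ^+ 2))%:E)%E.
Proof.
move=> mY Umono tail; have [m mP] := tail 3%R (lexx _).
exists m => q q3; have [c cP] := tail q q3.
have small (p : R) : (3 <= p)%R -> (4 * expR (- p ^+ 2) <= 4 / 10)%R.
  move=> p3; rewrite ler_pM2l// expRN lef_pV2 ?posrE ?expR_gt0//.
  by apply: le_trans (expR_ge1Dx _); nra.
have [w [wc wm]] : exists w, (`|Y w - c| < U q)%R /\ (`|Y w - m| < U 3)%R.
  apply/not_existsP => h.
  have : (P [set: T] <= (4 / 10 + 4 / 10)%:E)%E.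
    apply: (@prob_sub_union _ [set w | (U q <= `|Y w - c|)%R]
                             [set w | (U 3 <= `|Y w - m|)%R]) => //.
    - exact: measurable_ge_dist.
    - exact: measurable_ge_dist.
    - move=> w _ /=; have [Uq|Uq] := leP (U q) `|Y w - c|; [by left|right].
      by rewrite leNgt; apply/negP => Um; apply: (h w).
    - by rewrite (le_trans cP)// lee_fin small.
    - by rewrite (le_trans mP)// lee_fin small.
  by rewrite probability_setT lee_fin; lra.
apply: prob_sub cP; try exact: measurable_ge_dist.
move=> x /=; have := Umono q q3.
have := ler_normB (Y x - c) (Y w - c); have := ler_normD (Y x - Y w) (Y w - m).
rewrite (_ : Y x - c - (Y w - c) = Y x - Y w)%R; last by ring.
rewrite (_ : Y x - Y w + (Y w - m) = Y x - m)%R; last by ring.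
by lra.
Qed.

End recentering.

Section psd_tail.
Context d (T : measurableType d) (R : realType) (P : probability T R) (n : nat).
Variables (X : T -> 'cV[R]_n) (K : R).
Hypotheses (K0 : 0 < K) (X0 : mean_zero P X) (XK : convex_concentration P X K).
Local Notation Ex := (Ex P).
Local Notation intg := (intg P).

Variables (B : 'M[R]_n) (a v : R).
Hypotheses (Bsym : B^T = B) (Bpsd : forall x, 0 <= quad_form B x).
Hypotheses (a0 : 0 < a) (v0 : 0 <= v).
Hypotheses (Ba : forall x, enorm (B *m x) <= a * enorm x).
Hypotheses (Bv : Ex (fun w => enorm (B *m X w) ^+ 2) <= v ^+ 2).

Let Y w := quad_form B (X w).

Let mY : measurable_fun [set: T] Y.
Proof. exact: intg_measurable (intg_quad_form K0 X0 XK B). Qed.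

(** Truncate at [M = v + q K a]. The function [|B X|] is convex and
    [a]-Lipschitz with mean at most [v], so it exceeds [M] with probability at
    most [2 exp (- q^2)]; outside this event the form is equal to a convex
    [2 M]-Lipschitz function, whose deviation by [2 M q K] has the same bound.
    The centre is the mean of the truncation, hence depends on [q]. *)
Lemma psd_tail (q : R) : 0 < q ->
  exists c, (P [set w | (2 * (q * K * (v + q * K * a)) <= `|Y w - c|)%R]
     <= (4 * expR (- q ^+ 2))%:E)%E.
Proof.
move=> q0; set M := v + q * K * a.
have qKa : 0 < q * K * a by rewrite !mulr_gt0.
have M0 : 0 < M by rewrite ltr_wpDl.
have M2 : 0 < 2 * M by rewrite mulr_gt0.
have [gi gP] := lipschitz_concentration K0 XK a0 (cvx_enorm_mul B)
  (lipschitz_enorm_mul Ba).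
have [phi [phic phil phiE]] := convex_truncation Bsym Bpsd (ltW M0).
have [phii phiP] := lipschitz_concentration K0 XK M2 phic phil.
have gv : Ex (fun w => enorm (B *m X w)) <= v.
  rewrite -(@ler_pXn2r _ 2) ?nnegrE//; last by apply: Ex_ge0 => w; exact: enorm_ge0.
  apply: le_trans Bv; apply: Ex_sqr_le => //.
  exact: (second_moment_mulmx K0 X0 XK B).1.
exists (Ex (fun w => phi (X w))).
have qKM : 0 < 2 * (q * K * M) by rewrite !mulr_gt0.
have := gP _ qKa; have := phiP _ qKM.
rewrite (_ : (q * K * a) ^+ 2 / _ = q ^+ 2); last first.
  by field; rewrite !gt_eqF.
rewrite (_ : (2 * (q * K * M)) ^+ 2 / _ = q ^+ 2); last first.
  by field; rewrite !gt_eqF.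
rewrite (_ : 4 * expR _ = 2 * expR (- q ^+ 2) + 2 * expR (- q ^+ 2)); last by ring.
apply: prob_sub_union.
- exact: measurable_ge_dist.
- exact: measurable_ge_dist (intg_measurable phii).
- exact: measurable_ge_dist (intg_measurable gi).
move=> w /=; have [gM|gM] := leP (enorm (B *m X w)) M.
  by left; rewrite phiE.
move=> _; right; apply: le_trans (ler_norm _).
by move: gM; rewrite /M; lra.
Qed.

(** Replaces the centre [m] of [recenter] by the mean. With
    [W = K v + K^2 a] the tail around [m] at scale [s] is at most
    [exp 9 * exp (- s / (6 W))], whence [|E Y - m| <= 6 exp 9 W], and [W] is at
    most [2 t / q]. For [q] large this is at most [t / 4], and the remaining
    [t / 4] is covered by the level [q / 48] of [recenter]. *)
Lemma psd_tail_mean (q t : R) : 48 * expR 9 <= q -> 0 < t ->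
  q * (K * v) <= t -> q ^+ 2 * (K ^+ 2 * a) <= t ->
  (P [set w | (t / 2 <= `|Y w - Ex Y|)%R]
     <= (4 * expR (- (q / 48) ^+ 2))%:E)%E.
Proof.
move=> qL t0 tv ta.
have Kv0 : 0 <= K * v by rewrite mulr_ge0// ltW.
have Ka0 : 0 < K ^+ 2 * a by rewrite mulr_gt0// exprn_gt0.
pose U q := 2 * (q * K * (v + q * K * a)).
have UE p : U p = 2 * (p * (K * v) + p ^+ 2 * (K ^+ 2 * a)) by rewrite /U; ring.
have [p p3|p p3|m mP] := @recenter _ _ _ P Y U mY.
- rewrite !UE ler_pM2l// lerD//; first by rewrite ler_wpM2r.
  by rewrite ler_wpM2r ?(ltW Ka0)// ler_pXn2r ?nnegrE//; lra.
- by apply: psd_tail; lra.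
have e9 : 10 <= expR 9 :> R by apply: le_trans (expR_ge1Dx _); lra.
pose W := K * v + K ^+ 2 * a.
have W0 : 0 < W by rewrite ltr_wpDl.
have mi : intg (fun w => Y w - m).
  by apply: intgB (intg_cst _ _); exact: (intg_quad_form K0 X0 XK B).
have [_ mW] : intg (fun w => `|Y w - m|) /\
    Ex (fun w => `|Y w - m|) <= expR 9 * (6 * W).
  apply: tail_expectation.
  - by apply: measurableT_comp => //; exact: intg_measurable mi.
  - by [].
  - by rewrite mulr_gt0.
  - by lra.
  move=> s s0; have W6 : 0 < 6 * W by rewrite mulr_gt0.
  set z := s / (6 * W); have z0 : 0 < z by rewrite divr_gt0.
  have mYm : measurable_fun [set: T] (fun w => `|Y w - m|).
    by apply: measurableT_comp => //; exact: intg_measurable mi.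
  (* Below the threshold the factor [exp 9] makes the bound trivial. *)
  have [z9|z9] := leP z 9.
    rewrite (le_trans (probability_le1 _ _))//; first exact: measurable_gt.
    by rewrite lee_fin -expRD; apply: le_trans (expR_ge1Dx _); lra.
  pose p := Num.sqrt z.
  have pz : p ^+ 2 = z by rewrite sqr_sqrtr// ltW.
  have p3 : 3 <= p.
    rewrite -(@ler_pXn2r _ 2) ?nnegrE ?sqrtr_ge0//; by rewrite pz; lra.
  have Us : 3 * U p <= s.
    have -> : s = z * (6 * W) by rewrite /z mulfVK// gt_eqF.
    have pp : p * (K * v) <= p ^+ 2 * (K * v) by rewrite ler_wpM2r//; nra.
    by rewrite UE -pz /W; lra.
  have := mP _ p3; rewrite pz => mPp.
  apply: (@prob_sub _ _ _ _ _ _ _ _ _ _ (le_trans mPp _)).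
  - exact: measurable_gt.
  - exact: measurable_ge_dist.
  - by move=> w /= /ltW; apply: le_trans.
  - by rewrite lee_fin ler_wpM2r ?expR_ge0//; lra.
have q0 : 0 < q by lra.
have WT : expR 9 * (6 * W) <= t / 4.
  have h : q * W <= 2 * t.
    by rewrite /W mulrDr; have : q * (K ^+ 2 * a) <= q ^+ 2 * (K ^+ 2 * a);
      [rewrite ler_wpM2r ?(ltW Ka0)//; nra | lra].
  have h2 : 48 * expR 9 * W <= q * W by rewrite ler_wpM2r// ltW.
  by lra.
have q3 : 3 <= q / 48 by lra.
apply: prob_sub (mP _ q3); try exact: measurable_ge_dist.
(* The level [q / 48] costs at most [6 (t / 48 + t / 48 ^+ 2)]. *)
have UT : 3 * U (q / 48) <= t / 4 by rewrite UE; nra.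
move=> w /=; have := Ex_dist m (intg_quad_form K0 X0 XK B : intg Y).
have := ler_distD m (Y w) (Ex Y); rewrite [`|m - _|]distrC -/Y.
by lra.
Qed.

End psd_tail.

(** * The two-level tail bound *)

Section hanson_wright.
Context d (T : measurableType d) (R : realType) (P : probability T R) (n : nat).
Variables (X : T -> 'cV[R]_n) (K : R).
Hypotheses (K0 : 0 < K) (X0 : mean_zero P X) (XK : convex_concentration P X K).

(** Here [q ^+ 2] stands for the minimum in the theorem; cleared of
    denominators, the hypotheses also cover a vanishing covariance. *)
Lemma hanson_wright_scaled (A : 'M[R]_n) (t q : R) :
  0 < op_norm A -> 0 < t -> 0 <= q ->
  q ^+ 2 * (K ^+ 2 * hs_norm A ^+ 2 * op_norm (cov_mx P X)) <= t ^+ 2 ->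
  q ^+ 2 * (K ^+ 2 * op_norm A) <= t ->
  (P [set w | (t <= `|quad_form A (X w) -
                      Ex P (fun w => quad_form A (X w))|)%R]
     <= (2 * expR (- (q ^+ 2 / (2 * (48 * expR 9) ^+ 2))))%:E)%E.
Proof.
move=> a0 t0 q0 tv ta; set L := 48 * expR 9.
have e9 : 10 <= expR 9 :> R by apply: le_trans (expR_ge1Dx _); lra.
have L480 : 480 <= L by rewrite /L; lra.
have L0 : 0 < L by lra.
have mA (D : 'M[R]_n) : measurable_fun [set: T] (fun w => quad_form D (X w)).
  exact: intg_measurable (intg_quad_form K0 X0 XK D).
(* For small [q] the right-hand side is at least 1. *)
have [qL|qL] := leP q L.
  rewrite (le_trans (probability_le1 _ _))//; first exact: measurable_ge_dist.
  rewrite lee_fin.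
  have h : q ^+ 2 / (2 * L ^+ 2) <= 2^-1.
    rewrite ler_pdivrMr ?mulr_gt0 ?exprn_gt0// mulKf//.
    by rewrite ler_pXn2r ?nnegrE// ltW.
  by have := expR_ge1Dx (- (q ^+ 2 / (2 * L ^+ 2))); lra.
pose S := sym_part A; pose v := hs_norm A * Num.sqrt (op_norm (cov_mx P X)).
have v0 : 0 <= v by rewrite mulr_ge0 ?sqrtr_ge0.
have v2 : v ^+ 2 = hs_norm A ^+ 2 * op_norm (cov_mx P X).
  by rewrite /v exprMn [Num.sqrt (op_norm _) ^+ 2]sqr_sqrtr ?op_norm_ge0.
have qv : q * (K * v) <= t.
  rewrite -(@ler_pXn2r _ 2) ?nnegrE ?(ltW t0)//; last first.
    by rewrite mulr_ge0// mulr_ge0// ltW.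
  rewrite (_ : (q * (K * v)) ^+ 2 = q ^+ 2 * (K ^+ 2 * v ^+ 2)); last by ring.
  by rewrite v2 [K ^+ 2 * _]mulrA.
have [B [D [SBD [Bsym Dsym] psd le]]] := sym_decomposition (sym_part_sym A).
have op_le (F : 'M[R]_n) :
    (forall x, enorm (F *m x) <= enorm (S *m x)) ->
    forall x, enorm (F *m x) <= op_norm A * enorm x.
  by move=> FS x; apply: le_trans (FS x) (enorm_sym_part A x).
have mom (F : 'M[R]_n) :
    (forall x, enorm (F *m x) <= enorm (S *m x)) ->
    Ex P (fun w => enorm (F *m X w) ^+ 2) <= v ^+ 2.
  move=> FS; rewrite v2.
  have [Si SP] := second_moment_mulmx K0 X0 XK S.
  have [Fi _] := second_moment_mulmx K0 X0 XK F.
  apply: le_trans (Ex_le Fi Si _) (le_trans SP _).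
    by move=> w; rewrite ler_pXn2r ?nnegrE ?enorm_ge0.
  by rewrite ler_wpM2r ?op_norm_ge0// hs_sym_part.
have tail (F : 'M[R]_n) : F^T = F -> (forall x, 0 <= quad_form F x) ->
    (forall x, enorm (F *m x) <= enorm (S *m x)) ->
    (P [set w | (t / 2 <= `|quad_form F (X w) -
                        Ex P (fun w => quad_form F (X w))|)%R]
     <= (4 * expR (- (q / 48) ^+ 2))%:E)%E.
  move=> Fsym Fpsd FS.
  apply: (psd_tail_mean K0 X0 XK Fsym Fpsd a0 v0 (op_le _ FS) (mom _ FS)) => //.
  exact: ltW.
(* Half of the exponent [(q / 48) ^+ 2] absorbs the excess of the prefactor 8
   over 2. *)
have final : 4 * expR (- (q / 48) ^+ 2) + 4 * expR (- (q / 48) ^+ 2) <=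
    2 * expR (- (q ^+ 2 / (2 * L ^+ 2))).
  set z := q ^+ 2 / (2 * L ^+ 2).
  have h : expR (- (q / 48) ^+ 2) * 4 <= expR (- z).
    have -> : - z = - (q / 48) ^+ 2 + ((q / 48) ^+ 2 - z) by ring.
    rewrite expRD ler_wpM2l ?expR_ge0//; apply: le_trans (expR_ge1Dx _).
    have zq : z <= (q / 48) ^+ 2 / 2.
      have -> : z = (q / L) ^+ 2 / 2 by rewrite /z; field; rewrite gt_eqF.
      rewrite ler_wpM2r// ler_pXn2r ?nnegrE ?divr_ge0 ?(ltW L0)//.
      by rewrite ler_wpM2l// lef_pV2 ?posrE//; lra.
    have p10 : 10 <= q / 48 by lra.
    by nra.
  by lra.
rewrite -lee_fin in final; apply: le_trans final.
apply: prob_sub_union (tail _ Bsym _ _) (tail _ Dsym _ _).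
- exact: measurable_ge_dist.
- exact: measurable_ge_dist.
- exact: measurable_ge_dist.
- have AE x : quad_form A x = quad_form B x - quad_form D x.
    by rewrite -quad_sym_part SBD !quad_formE mulmxBl dotvBr.
  have ExE : Ex P (fun w => quad_form A (X w)) =
      Ex P (fun w => quad_form B (X w)) - Ex P (fun w => quad_form D (X w)).
    rewrite -ExB; [|exact: intg_quad_form K0 X0 XK _..].
    by congr Ex; apply/funext => w.
  move=> w /=; rewrite AE ExE.
  set b := quad_form B _; set b' := Ex P _; set e := quad_form D _.
  set e' := Ex P _ => h.
  have [hb|hb] := leP (t / 2) `|b - b'|; [by left|right].
  have := ler_normB (b - b') (e - e').
  by rewrite (_ : b - b' - (e - e') = b - e - (b' - e')); [lra|ring].
- by move=> x; case: (psd x).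
- by move=> x; case: (le x).
- by move=> x; case: (psd x).
- by move=> x; case: (le x).
Qed.

End hanson_wright.

Section ereal_quotients.
Context {R : realType}.

Lemma lee_div_antitone (t x y : R) : 0 < t -> 0 <= x -> x <= y ->
  (t%:E / y%:E <= t%:E / x%:E)%E.
Proof.
move=> t0 x0 xy; rewrite !inver; case: (eqVneq x 0) => [_|x_neq0].
  by rewrite mulry gtr0_sg// mul1e leey.
have x_gt0 : 0 < x by rewrite lt_neqAle eq_sym x_neq0.
have y_gt0 : 0 < y by apply: lt_le_trans xy.
by rewrite gt_eqF// -!EFinM lee_fin ler_pM2l// lef_pV2.
Qed.

Lemma mulr_le_of_le_ediv (r t y : R) : 0 < t -> 0 <= y ->
  (r%:E <= t%:E / y%:E)%E -> r * y <= t.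
Proof.
move=> t0 y0; rewrite inver; case: eqVneq => [->|y_neq0].
  by move=> _; rewrite mulr0 ltW.
have y_gt0 : 0 < y by rewrite lt_neqAle eq_sym y_neq0.
by rewrite -EFinM lee_fin ler_pdivlMr.
Qed.

End ereal_quotients.

(* MathComp-Analysis. In \bar R, x / 0 = +oo for 0 < x, and expeR -oo = 0. *)
Theorem theorem2p3 (R : realType) :
  exists C : R, 0 < C /\
  forall (n : nat) (hn : (1 <= n)%N) (K : R) (hK : 0 < K)
    (d : measure_display) (T : measurableType d) (P : probability T R)
    (X : T -> 'cV[R]_n) (hX : random_vector X) (hX0 : mean_zero P X)
    (hXK : convex_concentration P X K)
    (A : 'M[R]_n) (t : R) (ht : 0 < t),
  (P [set w | (t <= `|quad_form A (X w)
                      - fine 'E_P[fun v => quad_form A (X v)]%E|)%R]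
   <= 2%:E * expeR (- ((1 / C)%:E * Order.min
        ((t ^+ 2)%:E / (K ^+ 2 * hs_norm A ^+ 2 * op_norm (cov_mx P X))%:E)
        (t%:E / (K ^+ 2 * op_norm A)%:E)))
   <= 2%:E * expeR (- ((1 / C)%:E * Order.min
        ((t ^+ 2)%:E / (2 * K ^+ 4 * hs_norm A ^+ 2)%:E)
        (t%:E / (K ^+ 2 * op_norm A)%:E))))%E.
Proof.
have C0 : 0 < 2 * (48 * expR 9) ^+ 2 :> R.
  by rewrite mulr_gt0// exprn_gt0// mulr_gt0 ?expR_gt0.
exists (2 * (48 * expR 9) ^+ 2); split=> // n _ K K0 d T P X _ X0 XK A t t0.
set C := 2 * _ in C0 *.
have t2 : 0 < t ^+ 2 by rewrite exprn_gt0.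
have hs0 : 0 <= K ^+ 2 * hs_norm A ^+ 2 by rewrite mulr_ge0 ?sqr_ge0.
have Kc0 : 0 <= K ^+ 2 * hs_norm A ^+ 2 * op_norm (cov_mx P X).
  by rewrite mulr_ge0 ?op_norm_ge0.
have KA0 : 0 <= K ^+ 2 * op_norm A by rewrite mulr_ge0 ?op_norm_ge0 ?sqr_ge0.
apply/andP; split; last first.
  rewrite lee_pmul2l// lee_expeR leeN2 lee_pmul2l ?lte_fin ?divr_gt0//.
  rewrite le_min; apply/andP; split; last by rewrite ge_min lexx orbT.
  rewrite ge_min; apply/orP; left.
  apply: lee_div_antitone => //.
  rewrite (_ : 2 * K ^+ 4 * _ = K ^+ 2 * hs_norm A ^+ 2 * (2 * K ^+ 2));
    last by ring.
  by rewrite ler_wpM2l// (op_norm_cov_le K0 X0 XK).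
rewrite fine_expectation.
(* When [A = 0] both quotients are infinite and the event is empty; otherwise the
   minimum is a real number. *)
have [A0|A_neq0] := eqVneq (op_norm A) 0.
  have q0 x : quad_form A x = 0.
    by rewrite (op_norm_eq0 A0) quad_formE mul0mx /dotv mulmx0 mxE.
  rewrite (_ : [set w | _] = set0) ?measure0; first by rewrite mule_ge0 ?expeR_ge0.
  rewrite (_ : (fun _ => _) = (fun=> 0)); last first.
    by apply/funext => w; rewrite q0.
  rewrite Ex_cst; apply/seteqP; split => w //=.
  by rewrite q0 subr0 normr0 leNgt t0.
have a0 : 0 < op_norm A by rewrite lt_neqAle eq_sym A_neq0 op_norm_ge0.
set m := Order.min _ _.
have mle1 : (m <= (t ^+ 2)%:E /
    (K ^+ 2 * hs_norm A ^+ 2 * op_norm (cov_mx P X))%:E)%E.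
  by rewrite ge_min lexx.
have mle2 : (m <= t%:E / (K ^+ 2 * op_norm A)%:E)%E by rewrite ge_min lexx orbT.
have m0 : (0 <= m)%E.
  by rewrite le_min !mule_ge0// ?lee_fin ?(ltW t0) ?(ltW t2)// inve_ge0 lee_fin.
have mfin : m \is a fin_num.
  rewrite ge0_fin_numE//; apply: (le_lt_trans mle2).
  by rewrite inver gt_eqF ?mulr_gt0 ?exprn_gt0// -EFinM ltry.
move: mle1 mle2 m0; rewrite -(fineK mfin); set r := fine m => mle1 mle2.
rewrite lee_fin => r0.
rewrite -[X in (_ <= X)%E]/((2 * expR (- (1 / C * r)))%:E).
have rE : Num.sqrt r ^+ 2 = r by rewrite sqr_sqrtr.
rewrite (_ : 1 / C * r = Num.sqrt r ^+ 2 / C); last by rewrite rE; ring.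
apply: (hanson_wright_scaled K0 X0 XK) => //; rewrite ?sqrtr_ge0// rE.
  exact: mulr_le_of_le_ediv mle1.
exact: mulr_le_of_le_ediv mle2.
Qed.
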